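(* Let $q>2$ be a real number and $n\ge 3$ an integer. Then \[ |\mathsf{S}^{\mathrm{pl}}_n(q)| \;\ge\; \sqrt{F_{n-2}} =\Theta(\varphi^{n/2}), \] where $(F_k)_k$ is the Fibonacci sequence ($F_1=F_2=1$) and $\varphi=(1+\sqrt5)/2$ is the golden ratio. In particular, this holds for all integers $q\ge 3$.
   Context: $P_G(x)$ denotes the chromatic polynomial of $G$. $\mathsf{S}^{\mathrm{pl}}_n(q)\coloneqq\{P_G(q): G \text{ a simple planar graph on } n\text{ vertices}\}$. *)

(* Defs.v *)
From HB Require Import structures.
From mathcomp Require Import all_boot all_order all_algebra.
From mathcomp Require Import finmap.
From mathcomp Require Import all_classical all_reals all_analysis.

Set Implicit Arguments.
Unset Strict Implicit.
Unset Printing Implicit Defensive.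

Import Order.TTheory GRing.Theory Num.Theory.
Import numFieldTopology.Exports numFieldNormedType.Exports.

Local Open Scope classical_set_scope.
Local Open Scope ring_scope.

Fixpoint fib (n : nat) : nat :=
  match n with
  | 0 => 0
  | 1 => 1
  | (m.+1 as k).+1 => (fib k + fib m)%N
  end.

Definition golden_ratio (R : realType) : R := (1 + Num.sqrt 5) / 2.

Record sgraph := SGraph {
  vertex :> finType;
  adj : rel vertex;
  adj_sym : symmetric adj;
  adj_irrefl : irreflexive adj }.

(* A topological drawing in the plane.  The arc of an edge is parametrized from
   both of its ends, [arc_rev] making the two parametrizations describe the
   same curve; [arc u v] is irrelevant when [u] and [v] are not adjacent. *)
Record plane_drawing (R : realType) (G : sgraph)
    (pos : G -> R * R) (arc : G -> G -> R -> R * R) : Prop := PlaneDrawing {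
  pos_inj : injective pos;
  arc_continuous : forall u v, adj u v ->
    {within `[0, 1], continuous (arc u v)};
  arc_inj : forall u v, adj u v ->
    {in `[0, 1]%R &, injective (arc u v)};
  arc_start : forall u v, adj u v -> arc u v 0 = pos u;
  arc_end : forall u v, adj u v -> arc u v 1 = pos v;
  arc_rev : forall u v t, adj u v -> t \in `[0, 1]%R ->
    arc v u t = arc u v (1 - t);
  arc_avoids_vertices : forall u v w t, adj u v -> t \in `]0, 1[%R ->
    arc u v t <> pos w;
  arc_disjoint : forall u v u' v' s t, adj u v -> adj u' v' ->
    s \in `]0, 1[%R -> t \in `]0, 1[%R -> arc u v s = arc u' v' t ->
    [set u; v]%SET = [set u'; v']%SET }.

Definition planar (R : realType) (G : sgraph) : Prop :=
  exists pos arc, @plane_drawing R G pos arc.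

Definition proper_colorings (G : sgraph) (C : finType) : {set {ffun G -> C}} :=
  [set c : {ffun G -> C} | [forall x, forall y, adj x y ==> (c x != c y)]]%SET.

Definition is_chromatic_poly (R : realType) (G : sgraph) (p : {poly R}) : Prop :=
  forall k : nat, p.[k%:R] = #|proper_colorings G 'I_k|%:R.

(* Existence and uniqueness, which make this choice legitimate, are
   [chromatic_polyP] and [chromatic_poly_unique] below. *)
Definition chromatic_poly (R : realType) (G : sgraph) : {poly R} :=
  xget 0 [set p | is_chromatic_poly G p].

Definition planar_chromatic_values (R : realType) (n : nat) (q : R) : set R :=
  [set y | exists G : sgraph,
     [/\ #|G| = n, planar R G & y = (chromatic_poly R G).[q]]].

(* Colorings are sorted by the number of colors they use. *)

Definition onto_colorings (G : sgraph) (j : nat) : {set {ffun G -> 'I_j}} :=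
  [set c in proper_colorings G 'I_j | [set c x | x in G] == [set: 'I_j]]%SET.

Definition binomial_poly (R : realType) (j : nat) : {poly R} :=
  (j`!%:R)^-1 *: \prod_(i < j) ('X - i%:R%:P).

Lemma binomial_polyE (R : realType) (j k : nat) :
  (binomial_poly R j).[k%:R] = 'C(k, j)%:R.
Proof.
rewrite /binomial_poly hornerZ horner_prod.
have -> : \prod_(i < j) ('X - i%:R%:P).[k%:R] = (k ^_ j)%:R :> R.
  rewrite ffact_prod natr_prod.
  under [LHS]eq_bigr do rewrite hornerXsubC.
  have [jk|kj] := leqP j k.
    by apply: eq_bigr => i _; rewrite natrB// (leq_trans _ jk)// ltnW.
  rewrite (bigD1 (Ordinal kj))//= subrr mul0r.
  by rewrite (bigD1 (Ordinal kj))//= subnn mul0r.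
by rewrite -bin_ffact natrM mulrCA mulVf ?mulr1// pnatr_eq0 -lt0n fact_gt0.
Qed.

Lemma card_colorings_onto (G : sgraph) (k : nat) (J : {set 'I_k}) :
  #|[set c in proper_colorings G 'I_k | [set c x | x in G] == J]%SET| =
  #|onto_colorings G #|J| |.
Proof.
pose h (c : {ffun G -> 'I_#|J|}) : {ffun G -> 'I_k} := [ffun x => enum_val (c x)].
have h_inj : injective h.
  move=> c d /ffunP cd; apply/ffunP => x; move: (cd x).
  by rewrite !ffunE => /enum_val_inj.
rewrite -(card_imset _ h_inj); apply: eq_card => c; apply/idP/idP.
- rewrite inE => /andP[]; rewrite inE => /'forall_forallP cP /eqP cJ.
  have cin x : c x \in J by rewrite -cJ imset_f.
  apply/imsetP; exists [ffun x => enum_rank_in (cin x) (c x)].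
    rewrite !inE; apply/andP; split.
      apply/'forall_forallP => x y; apply/implyP => xy; rewrite !ffunE.
      apply: contra (implyP (cP x y) xy) => /eqP e.
      by rewrite -(enum_rankK_in (cin x) (cin x)) e enum_rankK_in.
    apply/eqP/setP => i; rewrite inE; apply/imsetP.
    have : enum_val i \in [set c x | x in G]%SET by rewrite cJ enum_valP.
    case/imsetP => x _ e; exists x => //; apply: enum_val_inj.
    by rewrite ffunE enum_rankK_in.
  by apply/ffunP => x; rewrite !ffunE enum_rankK_in.
- case/imsetP => d; rewrite !inE => /andP[/'forall_forallP dP /eqP dJ] ->.
  apply/andP; split.
    apply/'forall_forallP => x y; apply/implyP => xy; rewrite !ffunE.
    by apply: contra (implyP (dP x y) xy) => /eqP /enum_val_inj ->.
  apply/eqP/setP => i; apply/imsetP/idP => [[x _ ->]|iJ].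
    by rewrite ffunE enum_valP.
  have : enum_rank_in iJ i \in [set d x | x in G]%SET by rewrite dJ inE.
  by case/imsetP => x _ e; exists x => //; rewrite ffunE -e enum_rankK_in.
Qed.

Lemma onto_colorings_gt (G : sgraph) (j : nat) :
  (#|G| < j)%N -> #|onto_colorings G j| = 0%N.
Proof.
move=> Gj; apply/eqP; rewrite cards_eq0; apply/eqP/setP => c; rewrite !inE.
apply/negP => /andP[_ /eqP cT].
have := leq_imset_card c G.
by rewrite cT cardsT card_ord leqNgt Gj.
Qed.

Definition onto_poly (R : realType) (G : sgraph) : {poly R} :=
  \sum_(j < #|G|.+1) #|onto_colorings G j|%:R *: binomial_poly R j.

Lemma onto_polyP (R : realType) (G : sgraph) :
  is_chromatic_poly G (onto_poly R G).
Proof.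
move=> k; rewrite /onto_poly horner_sum.
under eq_bigr do rewrite hornerZ binomial_polyE -natrM.
rewrite -natr_sum; congr _%:R.
have -> : #|proper_colorings G 'I_k| =
    (\sum_(J : {set 'I_k}) #|onto_colorings G #|J| |)%N.
  rewrite -sum1_card.
  rewrite (partition_big (fun c : {ffun G -> 'I_k} => [set c x | x in G]%SET)
    predT)//=.
  apply: eq_bigr => J _; rewrite -card_colorings_onto -sum1_card.
  by apply: eq_bigl => c; rewrite [in RHS]inE.
rewrite (partition_big (fun J : {set 'I_k} => inord #|J| : 'I_(maxn #|G| k).+1)
  predT)//=.
have bnd (J : {set 'I_k}) : (#|J| < (maxn #|G| k).+1)%N.
  by rewrite ltnS leq_max -[X in _ || (_ <= X)%N](card_ord k) max_card orbT.
rewrite (big_ord_widen (maxn #|G| k).+1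
  (fun j => #|onto_colorings G j| * 'C(k, j)))%N ?ltnS ?leq_maxl//.
rewrite big_mkcond /=; apply: eq_bigr => j _.
under [RHS]eq_bigr => J /eqP Jj.
  have -> : #|J| = j by rewrite -Jj inordK.
  over.
rewrite sum_nat_const.
case: ltnP => [_|jG]; last by rewrite onto_colorings_gt ?muln0.
rewrite mulnC -[X in 'C(X, _)](card_ord k) -card_draws; congr muln.
apply: eq_card => J; rewrite !inE; apply/eqP/eqP => [e|<-].
  by rewrite -[LHS]/(nat_of_ord (inord #|J|)) inordK.
by rewrite -[RHS]/(nat_of_ord (inord #|J|)) inordK.
Qed.

Lemma chromatic_polyP (R : realType) (G : sgraph) :
  is_chromatic_poly G (chromatic_poly R G).
Proof.
by apply: (@xgetPex _ 0 [set p : {poly R} | is_chromatic_poly G p]);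
  exists (onto_poly R G); apply: onto_polyP.
Qed.

Lemma chromatic_poly_unique (R : realType) (G : sgraph) (p : {poly R}) :
  is_chromatic_poly G p -> p = chromatic_poly R G.
Proof.
move=> pP; apply/eqP; rewrite -subr_eq0; apply/negPn/negP => d0.
set d := p - _ in d0.
have := @max_poly_roots R d [seq i%:R | i <- iota 0 (size d)] d0.
rewrite size_map size_iota ltnn => H; suff : false by [].
apply: H.
  apply/allP => _ /mapP[i _ ->]; rewrite /root /d hornerD hornerN.
  by rewrite pP chromatic_polyP subrr.
by rewrite map_inj_uniq ?iota_uniq//; apply: mulrIn; exact: oner_neq0.
Qed.

Lemma finite_planar_chromatic_values (R : realType) (n : nat) (q : R) :
  finite_set (planar_chromatic_values n q).
Proof.
pose f (s : {ffun 'I_n.+1 -> 'I_(n ^ n).+1}) : R :=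
  (\sum_(j < n.+1) (s j)%:R *: binomial_poly R j).[q].
apply: (@sub_finite_set _ _ (f @` setT)); last first.
  by apply: finite_image; exact: finite_finset.
move=> y [G [Gn _ ->]] /=.
rewrite -(chromatic_poly_unique (onto_polyP R G)) /onto_poly.
subst n; exists [ffun j : 'I_#|G|.+1 => inord #|onto_colorings G j|] => //.
congr horner; apply: eq_bigr => j _; rewrite ffunE inordK// ltnS.
rewrite (leq_trans (max_card _))// card_ffun card_ord.
have [G0|G0] := posnP #|G|; first by rewrite [X in (_ ^ X <= _)%N]G0 expn0 expn_gt0 G0 orbT.
by rewrite leq_exp2r// -ltnS.
Qed.

(* Main.v *)
Require Import Defs.
From mathcomp Require Import all_boot all_order all_algebra.
From mathcomp Require Import finmap.
From mathcomp Require Import all_classical all_reals all_analysis.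
From mathcomp Require Import ring lra.

Set Implicit Arguments.
Unset Strict Implicit.
Unset Printing Implicit Defensive.

Import Order.TTheory GRing.Theory Num.Theory.
Import numFieldTopology.Exports numFieldNormedType.Exports.
Local Open Scope classical_set_scope.
Local Open Scope ring_scope.

(** For a graph with two terminals [u] and [v], let [a] and [b] count the
   [q]-colorings in which [u] and [v] get different, resp. equal, colors.
   Hanging a new vertex [w] on [v] and taking [u], [w] as terminals ("pendant")
   maps [(a, b)] to [((q - 2) a + (q - 1) b, a)]; joining a new vertex to both
   terminals ("ear") maps it to [((q - 2) a, (q - 1) b)].  Start from two
   isolated vertices and compose ears (one new vertex) with double pendants (two
   new vertices).  As [0 < a <= (q - 1) b] throughout, an ear produces
   [a <= (q - 2) b] while a double pendant produces [a > (q - 2) b], so distinct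
   words give distinct pairs, and [n - 3] added vertices yield [F_(n-2)] pairs.
   One last vertex, joined to both terminals or to none, turns a pair into two
   chromatic values of [n]-vertex planar graphs, [(q - 2) a + (q - 1) b] and
   [q (a + b)], which determine it.  Hence [F_(n-2)] is at most the square of
   the number of values. *)

(** * Adding one vertex with a prescribed neighborhood *)

Definition extend_adj (G : sgraph) (S : {set G}) : rel (option G) :=
  fun x y => match x, y with
  | Some a, Some b => adj a b
  | Some a, None | None, Some a => a \in S
  | None, None => false
  end.

Lemma extend_adj_sym (G : sgraph) (S : {set G}) : symmetric (extend_adj S).
Proof. by move=> [x|] [y|] //=; exact: adj_sym. Qed.

Lemma extend_adj_irrefl (G : sgraph) (S : {set G}) :
  irreflexive (extend_adj S).
Proof. by move=> [x|] //=; exact: adj_irrefl. Qed.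

Definition extend_graph (G : sgraph) (S : {set G}) : sgraph :=
  SGraph (extend_adj_sym S) (extend_adj_irrefl S).

Lemma card_extend_graph (G : sgraph) (S : {set G}) :
  #|extend_graph S| = #|G|.+1.
Proof. exact: card_option. Qed.

Definition extend_coloring (G C : finType) (d : {ffun G -> C}) (x : C) :
    {ffun option G -> C} :=
  [ffun o => if o is Some v then d v else x].

(** A proper coloring of the extension is a proper coloring [d] of [G] with a color for [None] that
    [d] does not use on [S]. The weight [F] is arbitrary so that colorings can also be sorted by
    agreement at the terminals. *)
Lemma sum_extend_colorings (R : nmodType) (G : sgraph) (S : {set G})
    (C : finType) (F : {ffun option G -> C} -> R) :
  \sum_(c in proper_colorings (extend_graph S) C) F c =
  \sum_(d in proper_colorings G C)
    \sum_(x | [forall s in S, d s != x]) F (extend_coloring d x).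
Proof.
rewrite pair_big_dep /=.
pose f (p : {ffun G -> C} * C) : {ffun option G -> C} :=
  extend_coloring p.1 p.2.
pose g (c : {ffun option G -> C}) := ([ffun v => c (Some v)] : {ffun G -> C}, c None).
have fK : cancel f g.
  by move=> [d x]; rewrite /g /f /= ffunE; congr pair; apply/ffunP => v; rewrite !ffunE.
have gK : cancel g f.
  by move=> c; apply/ffunP => -[v|]; rewrite !ffunE //= ffunE.
rewrite (reindex f); last by exists g => ? _; [exact: fK|exact: gK].
apply: eq_bigl => -[d x] /=; rewrite !inE.
apply/'forall_forallP/andP => [H|[/'forall_forallP dP /forallP xP]].
- split.
    apply/'forall_forallP => v w.
    by have := H (Some v) (Some w); rewrite /f !ffunE.
  by apply/forallP => v; have := H (Some v) None; rewrite /f !ffunE.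
- by move=> [v|] [w|]; rewrite /f !ffunE //= eq_sym.
Qed.

(** * Coloring counts sorted by the colors of two terminals *)

Section TwoTerminals.
Variable R : realType.

(** Excluding [y] leaves [k - 1] colors; excluding [z] removes one more exactly when [z != y]. *)
Lemma sum_neq2 (k : nat) (y z : 'I_k) :
  \sum_(x | y != x) (z != x)%:R = k%:R - 1 - (z != y)%:R :> R.
Proof.
have -> : k%:R - 1 = \sum_(x | y != x) 1 :> R.
  rewrite -[k in LHS]card_ord -sumr_const (bigD1 y) //= addrAC subrr add0r.
  by apply: eq_bigl => x; rewrite eq_sym.
have [->|zy] := eqVneq z y.
  by rewrite subr0; apply: eq_bigr => x ->.
rewrite (bigD1 z) 1?eq_sym //= eqxx add0r [in RHS](bigD1 z) 1?eq_sym //=.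
rewrite addrAC subrr add0r.
by apply: eq_bigr => x /andP[_]; rewrite eq_sym => ->.
Qed.

Lemma sum_neq_eq (k : nat) (y z : 'I_k) :
  \sum_(x | y != x) (z == x)%:R = (z != y)%:R :> R.
Proof.
have [->|zy] := eqVneq z y; first by rewrite big1 // => x /negbTE ->.
rewrite (bigD1 z) 1?eq_sym //= eqxx big1 ?addr0 // => x /andP[_].
by rewrite eq_sym => /negbTE ->.
Qed.

(** Colorings are counted only for natural [k]; polynomials interpolating the counts give the pair
    [(a, b)] a meaning at real [q]. *)
Definition terminal_polys (G : sgraph) (u v : G) (A B : {poly R}) : Prop :=
  forall k : nat,
    A.[k%:R] = \sum_(c in proper_colorings G 'I_k) (c u != c v)%:R /\
    B.[k%:R] = \sum_(c in proper_colorings G 'I_k) (c u == c v)%:R.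

Lemma card_proper_colorings_terminals (G : sgraph) (u v : G) A B (k : nat) :
  terminal_polys u v A B ->
  A.[k%:R] + B.[k%:R] = #|proper_colorings G 'I_k|%:R.
Proof.
move=> /(_ k)[-> ->]; rewrite -big_split -sum1_card natr_sum /=.
by apply: eq_bigr => c _; case: eqP => _; rewrite ?addr0 ?add0r.
Qed.

(** The new vertex takes one of the [k - 1] colors other than that of [v]. Exactly one of them is
    the color of [u] if [u] and [v] differ, and none is if they agree. *)
Lemma terminal_polys_pendant (G : sgraph) (u v : G) A B :
  terminal_polys u v A B ->
  @terminal_polys (extend_graph [set v]) (Some u) None
    (('X - 2%:P) * A + ('X - 1) * B) A.
Proof.
move=> AB k; have [Ak Bk] := AB k.
have all1 (d : {ffun G -> 'I_k}) x :
    [forall s in [set v]%SET, d s != x] = (d v != x).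
  apply/forall_inP/idP => [|H s /set1P -> //]; apply; exact: set11.
split; rewrite sum_extend_colorings.
- rewrite !hornerE Ak Bk !mulr_sumr -big_split /=; apply: eq_bigr => d _.
  rewrite (eq_bigl _ _ (all1 d)).
  under eq_bigr do rewrite /extend_coloring !ffunE.
  by rewrite sum_neq2; case: eqP => _ /=; rewrite ?mulr1 ?mulr0; ring.
- rewrite Ak; apply: eq_bigr => d _; rewrite (eq_bigl _ _ (all1 d)).
  under eq_bigr do rewrite /extend_coloring !ffunE.
  by rewrite sum_neq_eq.
Qed.

Lemma forall_set2_neq (G : sgraph) (u v : G) (C : finType) (d : {ffun G -> C}) x :
  [forall s in [set u; v]%SET, d s != x] = (d v != x) && (d u != x).
Proof.
apply/forall_inP/andP => [H|[dv du] s /set2P[]-> //].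
by split; apply: H; rewrite !inE eqxx ?orbT.
Qed.

(** The new vertex has [k - 2] colors to choose from when the terminals differ, [k - 1] when they
    agree. Taking [F] to be either indicator gives the two components of the ear rule. *)
Lemma sum_proper_colorings_ear (G : sgraph) (u v : G) (k : nat)
    (F : {ffun G -> 'I_k} -> R) :
  \sum_(c in proper_colorings (extend_graph [set u; v]) 'I_k)
    F [ffun x => c (Some x)] =
  \sum_(d in proper_colorings G 'I_k) (k%:R - 1 - (d u != d v)%:R) * F d.
Proof.
rewrite sum_extend_colorings; apply: eq_bigr => d _.
rewrite (eq_bigl _ _ (forall_set2_neq u v d)) big_mkcondr /= -sum_neq2 mulr_suml.
apply: eq_bigr => x _; have -> : [ffun v => extend_coloring d x (Some v)] = d.
  by apply/ffunP => w; rewrite !ffunE.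
by case: eqP => _ /=; rewrite ?mul1r ?mul0r.
Qed.

Lemma terminal_polys_ear (G : sgraph) (u v : G) A B :
  terminal_polys u v A B ->
  @terminal_polys (extend_graph [set u; v]) (Some u) (Some v)
    (('X - 2%:P) * A) (('X - 1) * B).
Proof.
move=> AB k; have [Ak Bk] := AB k; split.
- have := @sum_proper_colorings_ear G u v k (fun d => (d u != d v)%:R).
  under eq_bigr do rewrite !ffunE.
  move=> ->; rewrite !hornerE Ak mulr_sumr; apply: eq_bigr => d _.
  by case: eqP => _ /=; rewrite ?mulr1 ?mulr0 //; ring.
- have := @sum_proper_colorings_ear G u v k (fun d => (d u == d v)%:R).
  under eq_bigr do rewrite !ffunE.
  move=> ->; rewrite !hornerE Bk mulr_sumr; apply: eq_bigr => d _.
  by case: eqP => _ /=; rewrite ?mulr1 ?mulr0 //; ring.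
Qed.

Lemma chromatic_poly_ear (G : sgraph) (u v : G) A B :
  terminal_polys u v A B ->
  chromatic_poly R (extend_graph [set u; v]) = ('X - 2%:P) * A + ('X - 1) * B.
Proof.
move=> /terminal_polys_ear AB; apply/esym/chromatic_poly_unique => k.
by rewrite hornerD (card_proper_colorings_terminals _ AB).
Qed.

Lemma chromatic_poly_isolated (G : sgraph) (u v : G) A B :
  terminal_polys u v A B ->
  chromatic_poly R (@extend_graph G finset.set0) = 'X * (A + B).
Proof.
move=> AB; apply/esym/chromatic_poly_unique => k.
rewrite !hornerE (card_proper_colorings_terminals _ AB) -[in RHS]sum1_card.
rewrite sum_extend_colorings -[in LHS]sum1_card natr_sum mulr_sumr natr_sum.
apply: eq_bigr => d _; rewrite mulr1 -[k in LHS]card_ord -sum1_card; congr _%:R.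
by apply: eq_bigl => x; apply/esym/forall_inP => s; rewrite inE.
Qed.

Lemma edgeless_sym : symmetric (fun _ _ : unit => false). Proof. by []. Qed.
Lemma edgeless_irrefl : irreflexive (fun _ : unit => xpred0 : pred unit).
Proof. by []. Qed.
Definition point_graph : sgraph := SGraph edgeless_sym edgeless_irrefl.

Lemma terminal_polys_start :
  @terminal_polys (@extend_graph point_graph finset.set0) (Some tt) None
    ('X * ('X - 1)) 'X.
Proof.
move=> k.
have all1 (d : {ffun unit -> 'I_k}) x :
    [forall s in (finset.set0 : {set point_graph}), d s != x] = true.
  by apply/forall_inP => s; rewrite inE.
have card1 : \sum_(c in proper_colorings point_graph 'I_k) 1 = k%:R :> R.
  rewrite sumr_const; congr _%:R.
  have -> : proper_colorings point_graph 'I_k = [set: _]%SET.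
    by apply/setP => c; rewrite !inE; apply/'forall_forallP.
  by rewrite cardsT card_ffun card_unit card_ord expn1.
split; rewrite !hornerE sum_extend_colorings -{1}card1 ?mulr_suml.
- apply: eq_bigr => d _; rewrite mul1r.
  rewrite (eq_bigl _ _ (all1 d)) (bigD1 (d tt)) //=.
  rewrite /extend_coloring !ffunE eqxx add0r -[k in LHS]card_ord -sumr_const.
  rewrite (bigD1 (d tt)) //= addrAC subrr add0r; apply: eq_bigr => x.
  by rewrite !ffunE eq_sym => ->.
- apply: eq_bigr => d _.
  rewrite (eq_bigl _ _ (all1 d)) (bigD1 (d tt)) //= /extend_coloring !ffunE.
  rewrite eqxx big1 ?addr0 // => x; rewrite !ffunE eq_sym.
  by move=> /negbTE ->.
Qed.

End TwoTerminals.

(** * Straight-line drawings and their extension by one vertex *)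

Section StraightLine.
Variable R : realType.

Definition segment (p r : R * R) (t : R) : R * R :=
  (p.1 + t * (r.1 - p.1), p.2 + t * (r.2 - p.2)).

Lemma segment0 p r : segment p r 0 = p.
Proof. by rewrite /segment !mul0r !addr0; case: p. Qed.

Lemma segment1 p r : segment p r 1 = r.
Proof. by rewrite /segment !mul1r !(addrC _ (_ - _)) !subrK; case: r. Qed.

Lemma segment_rev p r t : segment r p t = segment p r (1 - t).
Proof. by rewrite /segment; congr pair; ring. Qed.

Lemma segment_continuous p r : continuous (segment p r).
Proof.
move=> t.
have affine (a b : R) : a + s * b @[s --> t] --> a + t * b.
  by apply: cvgD; [exact: cvg_cst|apply: cvgM; [exact: cvg_id|exact: cvg_cst]].
exact: cvg_pair (affine _ _) (affine _ _).
Qed.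

Lemma segment_inj p r : p <> r -> injective (segment p r).
Proof.
move=> pr s t [e1 e2]; apply/eqP; rewrite -subr_eq0; apply/negPn/negP => st.
apply: pr; case: p r e1 e2 => [p1 p2] [r1 r2] /= e1 e2.
have /eqP : (s - t) * (r1 - p1) = 0 by lra.
have /eqP : (s - t) * (r2 - p2) = 0 by lra.
rewrite !mulf_eq0 (negbTE st) /= !subr_eq0 => /eqP -> /eqP -> //.
Qed.

(** These are the conditions of [plane_drawing] that segments do not satisfy automatically; an edge
    is injective because its ends are distinct. *)
Record straight_drawing (G : sgraph) (pos : G -> R * R) : Prop := Straight {
  straight_inj : injective pos;
  straight_avoid : forall x y z t, adj x y -> 0 < t < 1 ->
    segment (pos x) (pos y) t <> pos z;
  straight_disjoint : forall x y x' y' s t, adj x y -> adj x' y' ->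
    0 < s < 1 -> 0 < t < 1 ->
    segment (pos x) (pos y) s = segment (pos x') (pos y') t ->
    [set x; y]%SET = [set x'; y']%SET }.

Lemma straight_planar (G : sgraph) (pos : G -> R * R) :
  straight_drawing pos -> planar R G.
Proof.
move=> [inj avoid disj]; exists pos, (fun u v => segment (pos u) (pos v)).
split=> //.
- by move=> u v _; apply: continuous_subspaceT; exact: segment_continuous.
- move=> u v uv s t _ _; apply: segment_inj => /inj e.
  by move: uv; rewrite e adj_irrefl.
- by move=> *; rewrite segment0.
- by move=> *; rewrite segment1.
- by move=> *; rewrite segment_rev.
Qed.

Definition convex_region (T : R * R -> Prop) : Prop :=
  forall p r t, T p -> T r -> 0 < t < 1 -> T (segment p r t).

Definition extend_pos (G : sgraph) (pos : G -> R * R) (p : R * R) :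
    option G -> R * R := fun o => if o is Some x then pos x else p.

Lemma onem_itv01 (t : R) : 0 < t < 1 -> 0 < 1 - t < 1.
Proof. by move=> /andP[? ?]; apply/andP; split; lra. Qed.

(** By convexity [T] contains the whole old drawing, while the new point and the open legs avoid
    [T]. Legs could then only cross each other, which the last hypothesis excludes. *)
Lemma extend_straight (G : sgraph) (S : {set G}) (pos : G -> R * R) (p : R * R)
    (T : R * R -> Prop) :
  straight_drawing pos -> convex_region T -> (forall x, T (pos x)) -> ~ T p ->
  (forall x t, x \in S -> 0 < t < 1 -> ~ T (segment (pos x) p t)) ->
  (forall x y s t, x \in S -> y \in S -> 0 < s < 1 -> 0 < t < 1 ->
     segment (pos x) p s = segment (pos y) p t -> x = y) ->
  @straight_drawing (extend_graph S) (extend_pos pos p).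
Proof.
move=> [inj avoid disj] Tconv Tpos Tp Tleg legs.
have pP x : pos x <> p by move=> e; apply: Tp; rewrite -e.
(* Up to reversal, an edge of the extension is an old one or a leg. *)
pose e_ (x y : option G) t := segment (extend_pos pos p x) (extend_pos pos p y) t.
have edgeP (x y : option G) t : extend_adj S x y -> 0 < t < 1 ->
    (exists a b, [/\ adj a b, [set x; y]%SET = [set Some a; Some b]%SET &
       e_ x y t = segment (pos a) (pos b) t]) \/
    (exists a t', [/\ a \in S, 0 < t' < 1, [set x; y]%SET = [set Some a; None]%SET &
       e_ x y t = segment (pos a) p t']).
  case: x => [x|]; case: y => [y|] //= h t01.
  - by left; exists x, y.
  - by right; exists x, t.
  - right; exists y, (1 - t); split=> //; first exact: onem_itv01.
      by rewrite finset.setUC.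
    by rewrite /e_ /= segment_rev.
have Tedge a b t : 0 < t < 1 -> T (segment (pos a) (pos b) t).
  by move=> t01; exact: Tconv.
split.
- move=> [x|] [y|] //= => [/inj -> //|/pP //|/esym/pP //].
- move=> x y z t xy t01; rewrite -/(e_ x y t).
  case: (edgeP x y t xy t01) => [[a [b [ab _ ->]]]|[a [t' [aS t'01 _ ->]]]].
    case: z => [z|] /=; first exact: avoid.
    by move=> e; apply: Tp; rewrite -e; exact: Tedge.
  case: z => [z|] /=.
    by move=> e; apply: (Tleg a t') => //; rewrite e.
  rewrite -[RHS](segment1 (pos a) p) => /(segment_inj (pP a)) e.
  by move: t'01; rewrite e ltxx andbF.
- move=> x y x' y' s t xy xy' s01 t01; rewrite -/(e_ x y s) -/(e_ x' y' t).
  case: (edgeP x y s xy s01) => [[a [b [ab -> ->]]]|[a [s' [aS s'01 -> ->]]]];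
  case: (edgeP x' y' t xy' t01) => [[c [d [cd -> ->]]]|[c [t' [cS t'01 -> ->]]]].
  + move=> /(disj _ _ _ _ _ _ ab cd s01 t01) /setP E.
    apply/setP => -[z|]; last by rewrite !inE.
    by have := E z; rewrite !inE.
  + by move=> e; case: (Tleg c t' cS t'01); rewrite -e; exact: Tedge.
  + by move=> e; case: (Tleg a s' aS s'01); rewrite e; exact: Tedge.
  + by move=> /(legs _ _ _ _ aS cS s'01 t'01) ->.
Qed.

End StraightLine.

(** * Growth of the Fibonacci numbers *)

Section Theta.
Variable R : realType.
Local Notation phi := (golden_ratio R).

Lemma golden_ratio_sqr : phi ^+ 2 = phi + 1.
Proof.
have s5 : Num.sqrt 5 ^+ 2 = 5 :> R by rewrite sqr_sqrtr.
by rewrite /golden_ratio expr_div_n sqrrD s5; field.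
Qed.

Lemma golden_ratio_exprSS (k : nat) : phi ^+ k.+2 = phi ^+ k.+1 + phi ^+ k.
Proof. by rewrite -addn2 exprD golden_ratio_sqr mulrDr mulr1 -exprSr. Qed.

Lemma golden_ratio_ge1 : 1 <= phi.
Proof.
have s5 : Num.sqrt 5 ^+ 2 = 5 :> R by rewrite sqr_sqrtr.
have s0 : 0 <= Num.sqrt 5 :> R by rewrite sqrtr_ge0.
rewrite /golden_ratio; nra.
Qed.

(** Powers of [phi] satisfy the Fibonacci recurrence, so an induction carrying two consecutive cases
    suffices. *)
Lemma fib_le_golden (k : nat) : (fib k)%:R <= phi ^+ k.
Proof.
have p1 := golden_ratio_ge1; have p0 : 0 <= phi by lra.
suff : (fib k)%:R <= phi ^+ k /\ (fib k.+1)%:R <= phi ^+ k.+1 by case.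
elim: k => [|k [IH1 IH2]]; first by rewrite /= expr0 expr1.
split=> //; rewrite [fib _]/= -/(fib k.+1) natrD.
by rewrite golden_ratio_exprSS lerD.
Qed.

(** Same recurrence; the factor [phi ^+ 2 = phi + 1] covers both base cases. *)
Lemma golden_le_fib (k : nat) : phi ^+ k <= phi ^+ 2 * (fib k.+1)%:R.
Proof.
have p1 := golden_ratio_ge1; have p0 : 0 <= phi by lra.
suff : phi ^+ k <= phi ^+ 2 * (fib k.+1)%:R /\
  phi ^+ k.+1 <= phi ^+ 2 * (fib k.+2)%:R by case.
elim: k => [|k [IH1 IH2]]; first by rewrite /= expr0 expr1 golden_ratio_sqr; lra.
split=> //; rewrite [fib k.+3]/= -/(fib k.+1) -/(fib k.+2) natrD mulrDr.
by rewrite golden_ratio_exprSS lerD.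
Qed.

Lemma sqrt_fib_Theta :
  (fun n : nat => Num.sqrt (fib (n - 2)%N)%:R : R^o)
    =Theta_\oo (fun n : nat => phi `^ (n%:R / 2) : R^o).
Proof.
have p1 := golden_ratio_ge1; have p0 : 0 < phi by lra.
have e (n : nat) : phi `^ (n%:R / 2) = Num.sqrt (phi ^+ n).
  by rewrite powRrM powR_mulrn ?ltW // powR12_sqrt // exprn_ge0 ?ltW.
rewrite eqThetaE qualifE; apply/asboolP.
(* The exponent 5 is 2 from [golden_le_fib] plus 3 from writing [n = m + 3]. Starting at 3 avoids
   [fib 0 = 0], where the lower bound fails. *)
exists ((Num.sqrt (phi ^+ 5))^-1, 1) => /=.
  by rewrite ltr01 invr_gt0 sqrtr_gt0 exprn_gt0.
exists 3%N => // n /= n3.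
rewrite e !ger0_norm ?sqrtr_ge0 // mul1r; split; last first.
  rewrite ler_wsqrtr // (le_trans (fib_le_golden _)) // ler_weXn2l //.
  exact: leq_subr.
rewrite ler_pdivrMl ?sqrtr_gt0 ?exprn_gt0 //.
rewrite -sqrtrM; last by rewrite exprn_ge0 // ltW.
rewrite ler_wsqrtr // -(subnK n3); set m := (n - 3)%N.
have -> : (m + 3 - 2 = m.+1)%N by rewrite -addnBA // addn1.
rewrite exprD (exprD _ 2 3) mulrAC ler_pM2r ?exprn_gt0 //.
exact: golden_le_fib.
Qed.

End Theta.

(** * Planar drawings of the pendant and ear constructions *)

Section Fan.
Variable R : realType.

(* The triangle with vertices [(-1, 0)], [(X, 0)] and [(0, H)]; the terminals
   are the first two, and each new vertex is placed just outside, at [(X + 1, 0)]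
   if pendant and at [(0, H + 1)] otherwise. *)
Definition triangle (X H : R) (p : R * R) : Prop :=
  [/\ 0 <= p.2, p.2 <= H * (1 + p.1) & H * p.1 + X * p.2 <= X * H].

Lemma triangle_convex X H : convex_region (triangle X H).
Proof.
move=> [a b] [c d] t [/= b0 b1 b2] [/= d0 d1 d2] /andP[t0 t1].
by split=> /=; nra.
Qed.

Lemma triangle_widen X H p : 0 < X -> 0 < H ->
  triangle X H p -> triangle (X + 1) H p.
Proof. by move: p => [x y] ? ? [/= ? ? ?]; split=> //=; nra. Qed.

Lemma triangle_raise X H p : 0 < X -> 0 < H ->
  triangle X H p -> triangle X (H + 1) p.
Proof.
move: p => [x y] X0 H0 [/= y0 yH yX].
(* Raising [H] by 1 adds the slacks [1 + x] and [X - x] to the two slanted inequalities. *)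
have x1 : 0 <= 1 + x by rewrite -(pmulr_rge0 _ H0); lra.
have xX : 0 <= X - x.
  by rewrite -(pmulr_rge0 _ H0); have := mulr_ge0 (ltW X0) y0; lra.
by split=> //=; lra.
Qed.

(** The invariant of the construction: both terminals stay at the ends of the base, reachable from
    the places reserved for the next vertex. *)
Definition fan (G : sgraph) (u v : G) (X H : R) : Prop :=
  exists pos : G -> R * R, [/\ straight_drawing pos,
    pos u = (-1, 0), pos v = (X, 0), 0 < X /\ 0 < H &
    forall x, triangle X H (pos x)].

(** The leg runs along the axis beyond [(X, 0)], violating the third inequality of [triangle]. *)
Lemma fan_pendant (G : sgraph) (u v : G) X H : fan u v X H ->
  @fan (extend_graph [set v]) (Some u) None (X + 1) H.
Proof.
move=> [pos [str pu pv [X0 H0] tri]].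
exists (extend_pos pos (X + 1, 0)); split=> //; last 1 first.
- move=> [x|] /=; first exact: triangle_widen.
  by split=> /=; nra.
- apply: (extend_straight str (@triangle_convex X H)) => //.
  + by move=> [/= _ _]; nra.
  + by move=> x t /set1P -> /andP[t0 t1]; rewrite pv /segment /= => -[/= _ _]; nra.
  + by move=> x y s t /set1P -> /set1P ->.
- by split=> //; lra.
Qed.

(** The leg from [u] violates the second inequality of [triangle], the leg from [v] the third. *)
Lemma fan_ear (G : sgraph) (u v : G) X H : fan u v X H ->
  @fan (extend_graph [set u; v]) (Some u) (Some v) X (H + 1).
Proof.
move=> [pos [str pu pv [X0 H0] tri]].
exists (extend_pos pos (0, H + 1)); split=> //; last 1 first.
- move=> [x|] /=; first exact: triangle_raise.
  by split=> /=; nra.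
- apply: (extend_straight str (@triangle_convex X H)) => //.
  + by move=> [/= _]; lra.
  + move=> x t /set2P[]-> /andP[t0 t1]; rewrite ?pu ?pv /segment /= => -[/=].
    * by move=> _ + _; nra.
    * by move=> _ _; nra.
  (* The first coordinate is negative along the open leg from [u] and positive along the one from
     [v]. *)
  + move=> x y s t /set2P[]-> /set2P[]-> // /andP[s0 s1] /andP[t0 t1];
      rewrite pu pv /segment /= => -[e _].
    * suff : X * (1 - t) <= 0 by rewrite leNgt mulr_gt0 // subr_gt0.
      by lra.
    * suff : X * (1 - s) <= 0 by rewrite leNgt mulr_gt0 // subr_gt0.
      by lra.
- by split=> //; lra.
Qed.

Lemma fan_isolated (G : sgraph) (u v : G) X H : fan u v X H ->
  planar R (@extend_graph G finset.set0).
Proof.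
move=> [pos [str pu pv [X0 H0] tri]].
apply: (@straight_planar _ (@extend_graph G finset.set0) (extend_pos pos (0, H + 1))).
apply: (extend_straight str (@triangle_convex X H)) => //.
- by move=> [/= _]; lra.
- by move=> x t; rewrite inE.
- by move=> x y s t; rewrite inE.
Qed.

Lemma fan_planar (G : sgraph) (u v : G) X H : fan u v X H -> planar R G.
Proof. by move=> [pos [/straight_planar]]. Qed.

Lemma fan_start :
  @fan (@extend_graph point_graph finset.set0) (Some tt) None 1 1.
Proof.
exists (extend_pos (fun _ : point_graph => (-1, 0)) (1, 0)); split=> //.
(* A single point serves as the convex region. *)
- apply: (@extend_straight _ _ _ _ _ (fun p => p = (-1, 0))) => //.
  + by split=> // [] [] [].
  + by move=> _ _ t -> -> _; rewrite /segment /= !subrr !mulr0 !addr0.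
  + by move=> [e]; lra.
  + by move=> x t; rewrite inE.
  + by move=> x y s t; rewrite inE.
- by move=> [x|] /=; split=> /=; lra.
Qed.

(** * Pairs realized by drawn two-terminal graphs *)

Definition realizable (q : R) (m : nat) (y : R * R) : Prop :=
  exists (G : sgraph) (u v : G) (X H : R) (A B : {poly R}),
    [/\ #|G| = m.+2, fan u v X H, terminal_polys u v A B &
        y = (A.[q], B.[q])].

Definition pendant_map (q : R) (y : R * R) : R * R :=
  ((q - 2) * y.1 + (q - 1) * y.2, y.1).

Definition ear_map (q : R) (y : R * R) : R * R :=
  ((q - 2) * y.1, (q - 1) * y.2).

Lemma realizable0 q : realizable q 0 (q * (q - 1), q).
Proof.
exists (@extend_graph point_graph finset.set0), (Some tt), None, 1, 1.
exists ('X * ('X - 1)), 'X; split.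
- by rewrite card_extend_graph card_unit.
- exact: fan_start.
- exact: terminal_polys_start.
- by rewrite !hornerE.
Qed.

Lemma realizable_pendant q m y :
  realizable q m y -> realizable q m.+1 (pendant_map q y).
Proof.
move=> [G [u [v [X [H [A [B [cG fG AB ->]]]]]]]].
exists (extend_graph [set v]), (Some u), None, (X + 1), H.
exists (('X - 2%:P) * A + ('X - 1) * B), A; split.
- by rewrite card_extend_graph cG.
- exact: fan_pendant.
- exact: terminal_polys_pendant.
- by rewrite /pendant_map !hornerE.
Qed.

Lemma realizable_ear q m y :
  realizable q m y -> realizable q m.+1 (ear_map q y).
Proof.
move=> [G [u [v [X [H [A [B [cG fG AB ->]]]]]]]].
exists (extend_graph [set u; v]), (Some u), (Some v), X, (H + 1).
exists (('X - 2%:P) * A), (('X - 1) * B); split.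
- by rewrite card_extend_graph cG.
- exact: fan_ear.
- exact: terminal_polys_ear.
- by rewrite /ear_map !hornerE.
Qed.

(** The last vertex brings [m + 2] vertices to [m + 3]: an ear gives the first value, an isolated
    vertex the second. *)
Lemma realizable_values q m y : realizable q m y ->
  planar_chromatic_values m.+3 q ((q - 2) * y.1 + (q - 1) * y.2) /\
  planar_chromatic_values m.+3 q (q * (y.1 + y.2)).
Proof.
move=> [G [u [v [X [H [A [B [cG fG AB ->]]]]]]]]; split.
- exists (extend_graph [set u; v]); rewrite card_extend_graph cG; split=> //.
    exact: fan_planar (fan_ear fG).
  by rewrite (chromatic_poly_ear AB) !hornerE.
- exists (@extend_graph G finset.set0); rewrite card_extend_graph cG; split=> //.
    exact: fan_isolated fG.
  by rewrite (chromatic_poly_isolated AB) !hornerE.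
Qed.

(** * Words in ears and double pendants, and the final count *)

Fixpoint fan_values (q : R) (m : nat) : seq (R * R) :=
  match m with
  | 0 => [:: (q * (q - 1), q)]
  | 1 => [:: ear_map q (q * (q - 1), q)]
  | (l.+1 as k).+1 => [seq ear_map q y | y <- fan_values q k] ++
      [seq pendant_map q (pendant_map q y) | y <- fan_values q l]
  end.

(** This replaces the two-step recursion by one rule for the empty word and one for each letter. *)
Lemma fan_values_ind q (P : nat -> R * R -> Prop) :
  P 0%N (q * (q - 1), q) ->
  (forall m y, P m y -> P m.+1 (ear_map q y)) ->
  (forall m y, P m y -> P m.+2 (pendant_map q (pendant_map q y))) ->
  forall m, {in fan_values q m, forall y, P m y}.
Proof.
move=> P0 Pear Ppend m.
suff : {in fan_values q m, forall y, P m y} /\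
  {in fan_values q m.+1, forall y, P m.+1 y} by case.
elim: m => [|m [IH1 IH2]].
  by split=> y; rewrite inE => /eqP -> //; exact: Pear.
split=> // y.
rewrite -[fan_values q _]/(map _ (fan_values q m.+1) ++ map _ (fan_values q m)).
rewrite mem_cat => /orP[] /mapP[z zin ->]; first exact: Pear (IH2 _ zin).
exact: Ppend (IH1 _ zin).
Qed.

Lemma size_fan_values q m : size (fan_values q m) = fib m.+1.
Proof.
suff : size (fan_values q m) = fib m.+1 /\ size (fan_values q m.+1) = fib m.+2.
  by case.
elim: m => [//|m [IH1 IH2]]; split=> //.
rewrite -[fan_values q _]/(map _ (fan_values q m.+1) ++ map _ (fan_values q m)).
by rewrite size_cat !size_map IH1 IH2.
Qed.

(** Equality holds at the start, and after a double pendant the upper bound reduces to the one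
    before it. A single pendant would instead require [(q - 1) * b <= a], hence the pairing. *)
Lemma fan_values_bound q m y : 2 < q -> y \in fan_values q m ->
  0 < y.1 <= (q - 1) * y.2.
Proof.
move=> q2; move: y.
apply: (@fan_values_ind q (fun _ y => is_true (0 < y.1 <= (q - 1) * y.2))).
- by rewrite /= mulrC lexx andbT; apply: mulr_gt0; lra.
- by move=> _ [a b] /andP[/= a0 ab]; apply/andP; split=> /=; nra.
- move=> _ [a b] /andP[/= a0 ab].
  have b0 : 0 < b by nra.
  have a1 : 0 < (q - 2) * a by apply: mulr_gt0; lra.
  have b1 : 0 < (q - 1) * b by apply: mulr_gt0; lra.
  by apply/andP; split=> /=; nra.
Qed.

Lemma ear_map_inj q : 2 < q -> injective (ear_map q).
Proof.
move=> q2 [a b] [c d] [/mulfI ac /mulfI bd].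
by rewrite ac ?bd //; apply: lt0r_neq0; lra.
Qed.

Lemma pendant_map_inj q : 2 < q -> injective (pendant_map q).
Proof.
move=> q2 [a b] [c d] [/= + ac]; rewrite ac => /addrI /mulfI -> //.
by apply: lt0r_neq0; lra.
Qed.

(* The ratio [y.1 / y.2] is at most [q - 2] after an ear and exceeds [q - 2]
   after two pendant steps, so the last step can be read off the value. *)
Lemma fan_values_uniq q m : 2 < q -> uniq (fan_values q m).
Proof.
move=> q2.
suff : uniq (fan_values q m) /\ uniq (fan_values q m.+1) by case.
elim: m => [//|m [IH1 IH2]]; split=> //.
rewrite -[fan_values q _]/(map _ (fan_values q m.+1) ++ map _ (fan_values q m)).
rewrite cat_uniq (map_inj_uniq (ear_map_inj q2)) IH2 andTb.
rewrite (map_inj_uniq (inj_comp (pendant_map_inj q2) (pendant_map_inj q2))) IH1.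
rewrite andbT; apply/hasPn => _ /mapP[[c d] /(fan_values_bound q2) cd ->].
apply/negP => /mapP[[a b] /(fan_values_bound q2) ab [e1 e2]].
move: ab cd e1 e2 => /andP[/= a0 ab] /andP[/= c0 cd] e1 e2.
have b0 : 0 < b by nra.
have : (q - 2) * a <= (q - 2) * ((q - 1) * b) by apply: ler_wpM2l => //; lra.
(* The inequality now cancels down to [(q - 1) * c <= 0]. *)
rewrite -e1 -e2.
have : 0 < (q - 1) * c by apply: mulr_gt0; lra.
lra.
Qed.

Lemma card_planar_chromatic_values (q : R) (n : nat) : 2 < q -> (3 <= n)%N ->
  Num.sqrt (fib (n - 2)%N)%:R
    <= #|` fset_set (planar_chromatic_values n q)|%fset%:R :> R.
Proof.
move=> q2 n3; set V := fset_set _.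
suff : (fib (n - 2) <= #|` V|%fset ^ 2)%N.
  rewrite -(ler_nat R) natrX => le.
  by rewrite -[leRHS]ger0_norm // -sqrtr_sqr ler_wsqrtr.
have [m nE] : exists m, n = m.+3 by exists (n - 3)%N; rewrite -addn3 subnK.
have -> : (n - 2 = m.+1)%N by rewrite nE.
rewrite -(size_fan_values q).
pose f (y : R * R) := ((q - 2) * y.1 + (q - 1) * y.2, q * (y.1 + y.2)).
have f_inj : injective f.
  move=> [a b] [c d] [/= e1 /mulfI e2].
  have {}e2 : a + b = c + d by apply: e2; apply: lt0r_neq0; lra.
  (* The first value is [(q - 2) * (a + b) + b], so the sum and this value determine [b]. *)
  have db : b = d by nra.
  by congr pair => //; lra.
(* The square is the size of [V] times [V], into which [f] sends the distinct pairs injectively. *)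
rewrite -(size_map f) -mulnn -(size_allpairs pair V V).
apply: uniq_leq_size; first by rewrite map_inj_uniq // fan_values_uniq.
move=> _ /mapP[y ym ->].
have Vfin := finite_planar_chromatic_values n q.
have [y1 y2] : planar_chromatic_values m.+3 q (f y).1 /\
    planar_chromatic_values m.+3 q (f y).2.
  apply: realizable_values; move: ym; apply: (@fan_values_ind q (realizable q)).
  - exact: realizable0.
  - exact: realizable_ear.
  - by move=> l z /realizable_pendant /realizable_pendant.
by apply: allpairs_f; rewrite /= in_fset_set // inE nE.
Qed.

End Fan.

Theorem theorem4p1 (R : realType) :
  [/\ forall (q : R) (n : nat), 2 < q -> (3 <= n)%N ->
        Num.sqrt (fib (n - 2)%N)%:R
          <= #|` fset_set (planar_chromatic_values n q)|%fset%:R :> R,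
      (fun n : nat => Num.sqrt (fib (n - 2)%N)%:R : R^o)
        =Theta_\oo (fun n : nat => golden_ratio R `^ (n%:R / 2) : R^o)
    & forall (q : int) (n : nat), 3 <= q -> (3 <= n)%N ->
        Num.sqrt (fib (n - 2)%N)%:R
          <= #|` fset_set (planar_chromatic_values n (q%:~R : R))|%fset%:R :> R].
Proof.
split; [exact: card_planar_chromatic_values|exact: sqrt_fib_Theta|].
move=> q n q3; apply: card_planar_chromatic_values.
by rewrite (ltr_int R 2) (lt_le_trans _ q3).
Qed.
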